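(* Let $S$ be a finite set and $\delta_S:S\to D(\mathbb{N}\times(M_{\mathrm{fin}}S)^\Sigma)$. There is a unique map $[\![-]\!]:S\to D(\mathbb{N}^{\Sigma^*})$ such that $[\![-]\!]=\mathrm{eval}\circ D(\mathrm{id}_{\mathbb{N}}\times(M_{\mathrm{fin}}[\![-]\!])^\Sigma)\circ\delta_S$.
   Context: $\Sigma$ is a finite alphabet, $\Sigma^*$ the finite strings, $\varepsilon$ the empty string. $\mathbb{N}^{\Sigma^*}$ is the set of functions $\alpha:\Sigma^*\to\mathbb{N}$ (multisets), with $\sigma$-algebra generated by the classes $[\alpha]_n=\{\beta:\beta(x)=\alpha(x)\text{ for all }|x|\le n\}$; $D(X)$ denotes probability measures on $X$ ($D(\mathbb{N}\times(M_{\mathrm{fin}}S)^\Sigma)$ for the countable set with discrete structure), $\delta_n$ Dirac, and $D(g)$ pushforward along $g$. $M_{\mathrm{fin}}X$ is the set of finite multisets over $X$, $M_{\mathrm{fin}}g$ applies $g$ elementwise. For a finite multiset $m$ of measures on $\mathbb{N}^{\Sigma^*}$, $\&m$ is the pushforward under pointwise summation of the product measure of its members (one factor per occurrence). Let $f:\mathbb{N}\times(\mathbb{N}^{\Sigma^*})^\Sigma\to\mathbb{N}^{\Sigma^*}$ be the bijection $f(n,(\beta_a)_{a})(\varepsilon)=n$, $f(n,(\beta_a)_a)(ay)=\beta_a(y)$. For a probability measure $\Phi$ on $\mathbb{N}\times(M_{\mathrm{fin}}D(\mathbb{N}^{\Sigma^*}))^\Sigma$, $\mathrm{eval}(\Phi)(A)=\int\big((\delta_n\otimes\bigotimes_{a\in\Sigma}\&m_a)\circ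 f^{-1}\big)(A)\,d\Phi(n,(m_a)_{a\in\Sigma})$. *)

(* Defs.v *)
From HB Require Import structures.
From mathcomp Require Import all_boot all_order all_algebra.
From mathcomp Require Import finmap multiset.
From mathcomp Require Import all_classical all_reals all_analysis giry.

Set Implicit Arguments.
Unset Strict Implicit.
Unset Printing Implicit Defensive.

Import Order.TTheory GRing.Theory Num.Theory.

Local Open Scope classical_set_scope.
Local Open Scope ereal_scope.

Section wlang.
Context (Sigma : finType).
Implicit Types (alpha beta : seq Sigma -> nat).

(* The class written [alpha]_n. *)
Definition cylinder alpha (n : nat) : set (seq Sigma -> nat) :=
  [set beta | forall x, (size x <= n)%N -> beta x = alpha x].

Definition cylinders : set (set (seq Sigma -> nat)) :=
  [set C | exists alpha n, C = cylinder alpha n].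

(* Multisets of strings (weighted languages), with the sigma-algebra generated
   by the cylinders. *)
Definition wlang := g_sigma_algebraType cylinders.

Lemma measurable_cylinder alpha n : measurable (cylinder alpha n : set wlang).
Proof. by apply: sub_sigma_algebra; exists alpha, n. Qed.

Lemma measurable_wlang_eval (x : seq Sigma) :
  measurable_fun [set: wlang] (fun beta : wlang => beta x).
Proof.
move=> _ Y _; rewrite setTI.
pose n := size x.
pose ext (c : {ffun n.-bseq Sigma -> nat}) (y : seq Sigma) : nat :=
  if insub y is Some b then c b else 0%N.
rewrite (_ : _ @^-1` _ = \bigcup_c
    (if `[< Y (ext c x) >] then cylinder (ext c) n else set0)).
  apply: countable_bigcupT_measurable => // c.
  by case: ifP => _; [exact: measurable_cylinder|exact: measurable0].
apply/seteqP; split => [beta /= Yb|beta [c _]]; last first.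
  by case: asboolP => // Yc /= /(_ x (leqnn _)) ->.
have extE y : (size y <= n)%N -> beta y = ext [ffun b => beta (val b)] y.
  by move=> yn; rewrite /ext insubT ffunE.
exists [ffun b => beta (val b)] => //; case: asboolP.
  by move=> _ y yn; exact: extE.
by rewrite -extE.
Qed.

Lemma measurable_fun_wlangP d (T : measurableType d) (f : T -> wlang) :
  (forall x, measurable_fun [set: T] (fun t => f t x)) ->
  measurable_fun [set: T] f.
Proof.
move=> mf; apply: (@measurability _ _ T wlang setT f cylinders) => //.
move=> _ [_ [alpha [n ->]] <-]; rewrite setTI.
rewrite (_ : f @^-1` _ = \bigcap_(b in [set: n.-bseq Sigma])
    ((fun t => f t (val b)) @^-1` [set alpha (val b)])).
  apply: fin_bigcap_measurable; first exact: finite_finset.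
  by move=> b _; rewrite -[X in measurable X]setTI; exact: mf.
apply/seteqP; split => [t ft b _|t ft x xn] /=.
  by apply: ft; exact: size_bseq.
by have := ft (Bseq xn) I.
Qed.

Definition wsum n (t : n.-tuple wlang) : wlang :=
  fun x => (\sum_(i < n) (tnth t i : seq Sigma -> nat) x)%N.

Let measurable_addn : measurable_fun [set: (nat * nat)%type]
  (fun p : nat * nat => (p.1 + p.2)%N).
Proof.
move=> _ Y _; rewrite setTI.
rewrite (_ : _ @^-1` _ = \bigcup_(p : nat * nat)
  (if `[< Y (p.1 + p.2)%N >] then [set p.1] `*` [set p.2] else set0)).
  apply: countable_bigcupT_measurable => // p.
  by case: ifP => _; [exact: measurableX|exact: measurable0].
apply/seteqP; split => [p /= Yp|p [q _]].
  by exists p => //; case: asboolP.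
by case: asboolP => // Yq [/= -> ->].
Qed.

Lemma measurable_wsum n : measurable_fun [set: n.-tuple wlang] (@wsum n).
Proof.
apply: measurable_fun_wlangP => x; rewrite /wsum.
suff mr (r : seq 'I_n) : measurable_fun [set: n.-tuple wlang]
    (fun t => (\sum_(i <- r) (tnth t i : seq Sigma -> nat) x)%N) by exact: mr.
elim: r => [|i r ih].
  rewrite [X in measurable_fun _ X](_ : _ = cst 0%N); first exact: measurable_cst.
  by apply/funext => t; rewrite big_nil.
rewrite [X in measurable_fun _ X](_ : _ = (fun p : nat * nat => (p.1 + p.2)%N) \o
    (fun t => ((tnth t i : seq Sigma -> nat) x,
      (\sum_(j <- r) (tnth t j : seq Sigma -> nat) x)%N))); last first.
  by apply/funext => t /=; rewrite big_cons.
apply: measurableT_comp; first exact: measurable_addn.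
apply: measurable_fun_pair => //.
have := measurableT_comp (measurable_wlang_eval x) (measurable_tnth i).
exact.
Qed.

HB.instance Definition _ n :=
  isMeasurableFun.Build _ _ _ _ (@wsum n) (@measurable_wsum n).

(* The bijection f: the function on pairs (n, (beta_a)_a) mapping the empty
   string to n and a :: y to beta_a y.  A family indexed by Sigma is encoded as
   a #|Sigma|-tuple, with component a at position enum_rank a. *)
Definition node (p : nat * #|Sigma|.-tuple wlang) : wlang :=
  fun x => if x is a :: y then (tnth p.2 (enum_rank a) : seq Sigma -> nat) y
           else p.1.

Lemma node_bij : bijective node.
Proof.
exists (fun beta => (beta [::],
    [tuple (fun y => beta (enum_val i :: y)) : wlang | i < #|Sigma|])).
- move=> [n t]; rewrite /node /=; congr pair.
  by apply: eq_from_tnth => i; rewrite tnth_mktuple /= enum_valK.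
- move=> beta; apply/funext => -[//|a y] /=.
  by rewrite /node /= tnth_mktuple enum_rankK.
Qed.

Lemma measurable_node :
  measurable_fun [set: (nat * #|Sigma|.-tuple wlang)%type] node.
Proof.
apply: measurable_fun_wlangP => -[|a y] /=; first exact: measurable_fst.
have mtnth : measurable_fun [set: (nat * #|Sigma|.-tuple wlang)%type]
    (fun p => tnth p.2 (enum_rank a)).
  have := measurableT_comp (measurable_tnth (T := wlang) (enum_rank a))
    (@measurable_snd _ _ nat (#|Sigma|.-tuple wlang)).
  exact.
have := measurableT_comp (measurable_wlang_eval y) mtnth.
exact.
Qed.

HB.instance Definition _ := isMeasurableFun.Build _ _ _ _ node measurable_node.

End wlang.

Section tuple_product.
Context d (T : measurableType d) (R : realType).

Definition tcons n (p : T * n.-tuple T) : n.+1.-tuple T :=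
  [the n.+1.-tuple T of p.1 :: p.2].

Lemma measurable_tcons n :
  measurable_fun [set: (T * n.-tuple T)%type] (@tcons n).
Proof. exact: measurable_cons. Qed.

HB.instance Definition _ n :=
  isMeasurableFun.Build _ _ _ _ (@tcons n) (@measurable_tcons n).

(* Iterated binary product; the value on boxes is tuple_productE. *)
Fixpoint tuple_product n : ('I_n -> probability T R) ->
    probability (n.-tuple T) R :=
  match n with
  | 0 => fun=> dirac [tuple]
  | n'.+1 => fun P => distribution
      (P ord0 \x tuple_product (fun i => P (lift ord0 i))) (@tcons n')
  end.

Lemma tuple_productE n (P : 'I_n -> probability T R) (A : 'I_n -> set T) :
  (forall i, measurable (A i)) ->
  tuple_product P [set t | forall i, A i (tnth t i)] =
  \big[*%E/1]_(i < n) P i (A i).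
Proof.
elim: n P A => [|n ih] P A mA.
  by rewrite big_ord0 /= diracE mem_set// => -[].
rewrite big_ord_recl -ih// -product_measure1E//; last first.
  rewrite (_ : [set t | _] = \bigcap_(i in [set: 'I_n])
    ((@tnth _ T ^~ i) @^-1` A (lift ord0 i))).
    apply: fin_bigcap_measurable; first exact: finite_finset.
    by move=> i _; rewrite -[X in measurable X]setTI; exact: measurable_tnth.
  by apply/seteqP; split => [t At i _|t At i]; exact: At.
rewrite /= /distribution /pushforward /=; congr (_ _).
apply/seteqP; split => [[x t] /= At|[x t] /= [Ax At] i].
- split; first exact: (At ord0).
  by move=> i; have := At (lift ord0 i); rewrite tnthS.
- have [j ->|->] := unliftP ord0 i; last exact: Ax.
  by rewrite tnthS; exact: At.
Qed.

End tuple_product.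

Definition mset_map (T U : choiceType) (g : T -> U) (m : {mset T}%mset) :
  {mset U}%mset := seq_mset [seq g x | x <- enum_mset m].

(* N * (M_fin T)^Sigma, with the discrete sigma-algebra, also when T is
   uncountable: every function out of it is then measurable.  For the image of a
   law on a countable discrete set this is no restriction. *)
Definition branch (Sigma : finType) (T : choiceType) : Type :=
  (nat * (Sigma -> {mset T}%mset))%type.

Section branch_measurable.
Context (Sigma : finType) (T : choiceType).

HB.instance Definition _ := gen_eqMixin (branch Sigma T).
HB.instance Definition _ := gen_choiceMixin (branch Sigma T).
HB.instance Definition _ :=
  isPointed.Build (branch Sigma T) (0%N, fun=> mset0).

Definition branch_display : measure_display.
Proof. exact. Qed.

HB.instance Definition _ := @isMeasurable.Build branch_display
  (branch Sigma T) discrete_measurable discrete_measurable0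
  discrete_measurableC discrete_measurableU.

Lemma measurable_branch (A : set (branch Sigma T)) : measurable A.
Proof. by []. Qed.

Lemma measurable_fun_branch d (U : measurableType d) D
  (f : branch Sigma T -> U) : measurable_fun D f.
Proof. by []. Qed.

End branch_measurable.

Section branch_map.
Context (Sigma : finType) (T U : choiceType) (g : T -> U).

Definition branch_map (b : branch Sigma T) : branch Sigma U :=
  (b.1, fun a => mset_map g (b.2 a)).

HB.instance Definition _ := isMeasurableFun.Build _ _ _ _ branch_map
  (@measurable_fun_branch _ _ _ _ setT branch_map).

End branch_map.

Section branch_eval.
Context (R : realType) (Sigma : finType).
Local Notation D := (probability (wlang Sigma) R).

(* A probability is a function on all subsets, unconstrained on non-measurable
   ones, so equality of elements of D is measure_eq (≡μ), not =. *)

(* The operator & on finite multisets of measures.  The members are listed, with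
   repetitions, in an arbitrary order, which is immaterial up to equality on
   measurable sets. *)
Definition mset_conv (m : {mset D}%mset) : D :=
  distribution (tuple_product (tnth (in_tuple (enum_mset m)))) (@wsum Sigma _).

(* (delta_n (x) (x)_a & m_a) o f^-1 for b = (n, (m_a)_a). *)
Definition branch_law (b : branch Sigma D) : D :=
  distribution
    (dirac b.1 \x tuple_product (fun i => mset_conv (b.2 (enum_val i))))
    (@node Sigma).

Section eval_probability.
Variable Phi : probability (branch Sigma D) R.

Definition branch_eval (A : set (wlang Sigma)) : \bar R :=
  \int[Phi]_b branch_law b A.

Let eval0 : branch_eval set0 = 0.
Proof. by apply: integral0_eq => b _; rewrite measure0. Qed.

Let eval_ge0 A : 0 <= branch_eval A.
Proof. by apply: integral_ge0 => b _; exact: measure_ge0. Qed.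

Let eval_sigma_additive : semi_sigma_additive branch_eval.
Proof.
move=> F mF tF mUF.
rewrite (_ : branch_eval _ = \sum_(n <oo) branch_eval (F n)); last first.
  rewrite /branch_eval -integral_nneseries//.
  by apply: eq_integral => b _; rewrite measure_semi_bigcup.
by apply: is_cvg_ereal_nneg_natsum => n _; exact: eval_ge0.
Qed.

HB.instance Definition _ :=
  isMeasure.Build _ _ _ branch_eval eval0 eval_ge0 eval_sigma_additive.

Let eval_setT : branch_eval setT = 1.
Proof.
rewrite /branch_eval (eq_integral (cst 1)) => [|b _]; last exact: probability_setT.
by rewrite integral_cst// mul1e; exact: (probability_setT Phi).
Qed.

HB.instance Definition _ :=
  Measure_isProbability.Build _ _ _ branch_eval eval_setT.

End eval_probability.

End branch_eval.

(* Main.v *)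
Require Import Defs.
From HB Require Import structures.
From mathcomp Require Import all_boot all_order all_algebra all_fingroup.
From mathcomp Require Import multiset.
From mathcomp Require Import all_classical all_reals all_analysis giry.

(* Two laws on weighted languages are compared level by level: they agree at
   level n when they give the same mass to every set that only depends on the
   weights of the strings of length < n.  The operator whose fixed points are
   the semantics reads the letters of a string one at a time, so it turns
   agreement at level n into agreement at level n + 1.  Hence two fixed points
   agree at every level, and they coincide because the level sets form a
   pi-system generating the sigma-algebra.  For existence, the iterates of the
   operator stabilize at each level and so define a content on the algebra of
   level sets; by the measure extension theorem it remains to see that this
   content is sigma-subadditive.  If a set A had a cover of smaller total mass,
   one of the countably many classes of A at level 1 would be covered by too
   little mass, then one of its subclasses at level 2, and so on; the limit of
   the resulting branch is a point of A outside the cover. *)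

Set Implicit Arguments.
Unset Strict Implicit.
Unset Printing Implicit Defensive.

Import Order.TTheory GRing.Theory Num.Theory.

Local Open Scope classical_set_scope.
Local Open Scope ereal_scope.

(** * Level sets and agreement *)

Section restriction.
Context (Sigma : finType).
Implicit Types (alpha beta : wlang Sigma) (A : set (wlang Sigma)).

(** The bound is strict so that level 0 carries no information and agreement there is free
    ([agree0]). The price is a shift: [cylinder alpha n] is a set of level n + 1. *)
Definition restrict n beta : wlang Sigma :=
  fun x => if (size x < n)%N then (beta : seq Sigma -> nat) x else 0%N.

Lemma restrict0 : restrict 0 = cst (fun=> 0%N).
Proof. by []. Qed.

Lemma restrict_comp m n beta :
  restrict m (restrict n beta) = restrict (minn m n) beta.
Proof.
apply/funext => x; rewrite /restrict leq_min.
by case: (size x < m)%N; case: (size x < n)%N.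
Qed.

Lemma restrict_idem m n A : (n <= m)%N ->
  restrict m @^-1` (restrict n @^-1` A) = restrict n @^-1` A.
Proof.
move=> nm; apply/funext => beta /=.
by rewrite /preimage/= restrict_comp (minn_idPl nm).
Qed.

Lemma eq_restrictP n alpha beta :
  (forall x, (size x < n)%N -> (alpha : seq Sigma -> nat) x = beta x) <->
  restrict n alpha = restrict n beta.
Proof.
split=> [ab|/[swap] x /(congr1 (fun f : seq Sigma -> nat => f x)) + xn].
  by apply/funext => x; rewrite /restrict; case: ifPn => // /ab.
by rewrite /restrict xn.
Qed.

Lemma cylinder_restrict alpha n :
  cylinder alpha n = restrict n.+1 @^-1` [set restrict n.+1 alpha].
Proof.
by apply/seteqP; split => beta h; exact: (eq_restrictP n.+1 beta alpha).1 h ||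
  exact: (eq_restrictP n.+1 beta alpha).2 h.
Qed.

(** Only finitely many strings have length at most n, so the codes form a countable type. A code
    determines a class at level n + 1, not n. *)
Definition code n beta : {ffun n.-bseq Sigma -> nat} :=
  [ffun b : n.-bseq Sigma => (beta : seq Sigma -> nat) (val b)].

Definition decode n (c : {ffun n.-bseq Sigma -> nat}) : wlang Sigma :=
  fun x => if insub x is Some b then c b else 0%N.

Lemma code_eq n alpha beta : code n alpha = code n beta <->
  restrict n.+1 alpha = restrict n.+1 beta.
Proof.
split=> [/ffunP ab|/eq_restrictP ab].
  apply/eq_restrictP => x xn; have := ab (Bseq (xn : size x <= n)%N).
  by rewrite !ffunE.
by apply/ffunP => b; rewrite !ffunE; apply: ab; rewrite ltnS size_bseq.
Qed.

Lemma codeK n beta : restrict n (decode (code n beta)) = restrict n beta.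
Proof.
apply/eq_restrictP => x /ltnW xn.
by rewrite /decode insubT ffunE.
Qed.

(** Such a set is a countable union of cylinders, one for each admissible code, whatever A is. This
    is why [agree] can quantify over all sets A. *)
Lemma measurable_restrict_preimage n A : measurable (restrict n @^-1` A).
Proof.
rewrite (_ : _ @^-1` _ = \bigcup_(c : {ffun n.-bseq Sigma -> nat})
    (if `[< A (restrict n (decode c)) >] then cylinder (decode c) n else set0)).
  apply: countable_bigcupT_measurable => // c.
  by case: ifP => _; [exact: measurable_cylinder|exact: measurable0].
apply/seteqP; split => [beta /= Ab|beta [c _]]; last first.
  case: asboolP => // Ac /= cb.
  suff -> : restrict n beta = restrict n (decode c) by [].
  by apply/eq_restrictP => x /ltnW; exact: cb.
exists (code n beta) => //; case: asboolP; last by rewrite codeK.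
by move=> _ x xn; rewrite /decode insubT ffunE.
Qed.

End restriction.

Section agreement.
Context (R : realType) (Sigma : finType).
Local Notation D := (probability (wlang Sigma) R).

Definition agree n (P Q : D) :=
  forall A, P (restrict n @^-1` A) = Q (restrict n @^-1` A).

Lemma agree_le m n P Q : (m <= n)%N -> agree n P Q -> agree m P Q.
Proof. by move=> mn PQ A; rewrite -(restrict_idem A mn). Qed.

Lemma agree_sym n P Q : agree n P Q -> agree n Q P.
Proof. by move=> PQ A. Qed.

Lemma agree_trans n P2 P1 P3 : agree n P1 P2 -> agree n P2 P3 -> agree n P1 P3.
Proof. by move=> P12 P23 A; rewrite P12. Qed.

Lemma measure_eq_agree n (P Q : D) : P ≡μ Q -> agree n P Q.
Proof. by move=> PQ A; apply: PQ; exact: measurable_restrict_preimage. Qed.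

Lemma agree0 P Q : agree 0 P Q.
Proof.
move=> A; rewrite restrict0 preimage_cst.
by case: ifP => _; rewrite ?measure0 ?probability_setT.
Qed.

Lemma agree_measure_eq (P Q : D) : (forall n, agree n P Q) -> P ≡μ Q.
Proof.
move=> PQ A mA.
pose G := [set C : set (wlang Sigma) | exists n B, C = restrict n @^-1` B].
apply: (measure_unique G (fun=> setT)) => //.
- apply/seteqP; split; last first.
    apply: smallest_sub; first exact: sigma_algebra_measurable.
    by move=> _ [n [B ->]]; exact: measurable_restrict_preimage.
  apply: smallest_sub; first exact: smallest_sigma_algebra.
  move=> _ [alpha [n ->]]; apply: sub_sigma_algebra.
  by exists n.+1; eexists; exact: cylinder_restrict.
- move=> _ _ [m [B ->]] [n [C ->]]; exists (maxn m n).
  exists (restrict m @^-1` B `&` restrict n @^-1` C).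
  by rewrite preimage_setI !restrict_idem ?leq_maxl ?leq_maxr.
- by move=> _; exists 0%N, setT; rewrite preimage_setT.
- by apply/seteqP; split => // x _; exists 0%N.
- by move=> _ [n [B ->]]; exact: PQ.
- by move=> _; rewrite [X in X < _]probability_setT ltry.
Qed.

End agreement.

(** * Products of measures on tuples *)

Section tuple_product_theory.
Context d (T : measurableType d) (R : realType).

Lemma measurable_box n (A : 'I_n -> set T) : (forall i, measurable (A i)) ->
  measurable [set t : n.-tuple T | forall i, A i (tnth t i)].
Proof.
move=> mA; rewrite (_ : mkset _ = \bigcap_(i in [set: 'I_n])
    ((@tnth _ T ^~ i) @^-1` A i)); last first.
  by apply/seteqP; split => [t At i _|t At i]; exact: At.
apply: fin_bigcap_measurable; first exact: finite_finset.
by move=> i _; rewrite -[X in measurable X]setTI; exact: measurable_tnth.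
Qed.

Lemma box_measure_unique n (mu nu : probability (n.-tuple T) R) :
  (forall A : 'I_n -> set T, (forall i, measurable (A i)) ->
    mu [set t | forall i, A i (tnth t i)] =
    nu [set t | forall i, A i (tnth t i)]) ->
  mu ≡μ nu.
Proof.
move=> munu B mB.
pose G := [set C : set (n.-tuple T) | exists2 A : 'I_n -> set T,
  (forall i, measurable (A i)) & C = [set t | forall i, A i (tnth t i)]].
apply: (measure_unique G (fun=> setT)) => //.
- apply/seteqP; split; last first.
    apply: smallest_sub; first exact: sigma_algebra_measurable.
    by move=> _ [A mA ->]; exact: measurable_box.
  apply: smallest_sub; first exact: smallest_sigma_algebra.
  move=> C /= GC; apply: sub_sigma_algebra; move: C GC.
  apply: (big_ind (fun X => forall C, X C -> G C)) => [//||].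
    by move=> X Y GX GY C [/GX|/GY].
  move=> i _ _ [A mA <-].
  (* A generator constrains a single coordinate, so it is a box whose other sides are full. *)
  exists (fun j => if j == i then A else setT) => [j|]; first by case: ifP.
  apply/seteqP; split => [t [_ At] j|t At] /=; first by case: eqP => [->|].
  by split => //; have := At i; rewrite eqxx.
- move=> _ _ [A mA ->] [C mC ->]; exists (fun i => A i `&` C i).
    by move=> i; exact: measurableI.
  apply/seteqP; split => [t [At Ct] i|t ACt] /=; first by split.
  by split => i; have [] := ACt i.
- by move=> _; exists (fun=> setT) => //; apply/seteqP; split.
- by apply/seteqP; split => // x _; exists 0%N.
- by move=> _ [A mA ->]; exact: munu.
- by move=> _; rewrite [X in X < _]probability_setT ltry.
Qed.

Lemma eq_tuple_product n (P Q : 'I_n -> probability T R) :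
  (forall i, P i ≡μ Q i) -> tuple_product P ≡μ tuple_product Q.
Proof.
move=> PQ; apply: box_measure_unique => A mA.
by rewrite !tuple_productE//; apply: eq_bigr => i _; exact: PQ.
Qed.

End tuple_product_theory.

Section perm_map_tuple.
Context d (T : measurableType d) (R : realType).
Variables (n : nat) (p : {perm 'I_n}) (f : {mfun T >-> T}).

(** One map serves two purposes: with [f] the identity it shows that the order of the factors is
    immaterial to [conv], and with [p] trivial it truncates every component. *)
Definition perm_map (t : n.-tuple T) : n.-tuple T :=
  [tuple f (tnth t (p i)) | i < n].

Lemma measurable_perm_map : measurable_fun [set: n.-tuple T] perm_map.
Proof.
apply/measurable_fun_tnthP => i.
rewrite (_ : _ \o _ = f \o (@tnth _ T ^~ (p i))).
  by apply: measurableT_comp => //; exact: measurable_tnth.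
by apply/funext => t /=; rewrite tnth_mktuple.
Qed.

HB.instance Definition _ :=
  isMeasurableFun.Build _ _ _ _ perm_map measurable_perm_map.

Lemma tuple_product_perm_map (P : 'I_n -> probability T R) :
  distribution (tuple_product P) perm_map ≡μ
  tuple_product (fun i => distribution (P (p i)) f).
Proof.
apply: box_measure_unique => A mA; rewrite tuple_productE//.
rewrite /= /distribution /pushforward.
rewrite (_ : perm_map @^-1` _ =
    [set t | forall i, (f @^-1` A ((p^-1)%g i)) (tnth t i)]).
  rewrite (tuple_productE P (A := fun i => f @^-1` A ((p^-1)%g i))); last first.
    by move=> i; rewrite -[X in measurable X]setTI; exact: measurable_funPT.
  rewrite (reindex_perm p); apply: eq_bigr => i _ /=.
  by rewrite permK.
apply/seteqP; split => t /= At i.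
  by have := At ((p^-1)%g i); rewrite tnth_mktuple permKV.
by have := At (p i); rewrite tnth_mktuple permK.
Qed.

End perm_map_tuple.

HB.instance Definition _ d (T : measurableType d) :=
  isMeasurableFun.Build _ _ T T (@idfun T) (@measurable_id _ T setT).

(** * Unfolding one letter *)

Section unfolding.
Context (R : realType) (Sigma : finType).
Local Notation D := (probability (wlang Sigma) R).

Lemma measurable_restrict n : measurable_fun [set: wlang Sigma] (restrict n).
Proof. by move=> _ A _; rewrite setTI; exact: measurable_restrict_preimage. Qed.

HB.instance Definition _ n :=
  isMeasurableFun.Build _ _ _ _ (@restrict Sigma n) (@measurable_restrict n).

Local Notation restricts n := (perm_map 1%g (@restrict Sigma n)).

(** Since [B] only sees truncated components, both masses can be computed after pushing forward
    along the truncation, where corresponding factors become equal measures. *)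
Lemma tuple_product_agree n k (P Q : 'I_k -> D)
    (B : set (k.-tuple (wlang Sigma))) :
  (forall i, agree n (P i) (Q i)) -> measurable B ->
  restricts n @^-1` B = B -> tuple_product P B = tuple_product Q B.
Proof.
move=> PQ mB BE.
have TE := tuple_product_perm_map 1%g (@restrict Sigma n) _ mB.
have := TE R P; have := TE R Q.
rewrite /= /distribution /pushforward BE => -> ->.
by apply: (eq_tuple_product _ mB) => i A _; rewrite perm1; exact: PQ.
Qed.

Definition conv n (t : n.-tuple D) : D :=
  distribution (tuple_product (tnth t)) (@wsum Sigma n).

Lemma conv_in_tuple n (t : n.-tuple D) : conv (in_tuple t) = conv t.
Proof.
(* Replacing n by [size s] makes the types of the two tuples coincide. *)
case: t => s sn; have sE := eqP sn; case: n / sE sn => sn.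
by congr conv; exact: val_inj.
Qed.

Lemma conv_perm n (s t : n.-tuple D) : perm_eq s t -> conv s ≡μ conv t.
Proof.
move=> /tuple_permP[p sE] A mA.
have {}sE : s = [tuple tnth t (p i) | i < n] by exact: val_inj.
have mS : measurable (@wsum Sigma n @^-1` A).
  by rewrite -[X in measurable X]setTI; exact: measurable_wsum.
rewrite /conv /= /distribution /pushforward.
transitivity (tuple_product (fun i => tnth t (p i)) (@wsum Sigma n @^-1` A)).
  congr (tuple_product _ _); apply/funext => i.
  by rewrite sE tnth_mktuple.
have := tuple_product_perm_map p (@idfun (wlang Sigma)) (tnth t) mS.
rewrite /= /distribution /pushforward.
rewrite (_ : perm_map p _ @^-1` _ = @wsum Sigma n @^-1` A).
  move=> ->; apply: (eq_tuple_product _ mS) => i B _.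
  by rewrite /= /distribution /pushforward preimage_id.
apply/funext => u; rewrite /preimage/=; congr A; apply/funext => x.
rewrite /wsum [RHS](reindex_perm p); apply: eq_bigr => i _.
by rewrite tnth_mktuple.
Qed.

(** The listing chosen for [mset_map g m] may depend on [g]. Listing along [m] instead lets two maps
    be compared factor by factor. *)
Lemma mset_conv_map (T : choiceType) (g : T -> D) (m : {mset T}%mset) :
  mset_conv (mset_map g m) ≡μ conv (map_tuple g (in_tuple (enum_mset m))).
Proof.
have mE : perm_eq (mset_map g m) (map g m) by exact: perm_eq_seq_mset.
have ms : size (mset_map g m) == size m.
  by rewrite (perm_size mE) size_map.
have -> : mset_conv (mset_map g m) = conv (Tuple ms).
  by rewrite -[RHS]conv_in_tuple.
exact: conv_perm.
Qed.

Lemma mset_conv_agree (T : choiceType) (g h : T -> D) n (m : {mset T}%mset) :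
  (forall x, agree n (g x) (h x)) ->
  agree n (mset_conv (mset_map g m)) (mset_conv (mset_map h m)).
Proof.
move=> gh.
apply: (agree_trans (measure_eq_agree n (mset_conv_map g m))).
apply: agree_trans; last first.
  exact: agree_sym (measure_eq_agree n (mset_conv_map h m)).
move=> A; apply: (@tuple_product_agree n) => [i||].
- by rewrite !tnth_map.
- rewrite -[X in measurable X]setTI; apply: measurable_wsum => //.
  exact: measurable_restrict_preimage.
- apply/funext => t; rewrite /preimage/=; congr A.
  apply/eq_restrictP => x xn; rewrite /wsum; apply: eq_bigr => i _.
  by rewrite tnth_mktuple perm1 /= /restrict xn.
Qed.

(** The extra level arises because the weight of [a :: y], of length below n + 1, is read from
    component a at [y], of length below n. The root weight follows the same Dirac measure on both
    sides. *)
Lemma branch_law_agree (T : choiceType) (g h : T -> D) n (b : branch Sigma T) :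
  (forall x, agree n (g x) (h x)) ->
  agree n.+1 (branch_law (branch_map g b)) (branch_law (branch_map h b)).
Proof.
move=> gh A; rewrite /branch_law /= /distribution /pushforward /=.
have mA : measurable (@node Sigma @^-1` (restrict n.+1 @^-1` A)).
  rewrite -[X in measurable X]setTI; apply: measurable_node => //.
  exact: measurable_restrict_preimage.
rewrite /product_measure1 !integral_dirac//=;
  try exact: measurable_fun_xsection.
congr (_ * _); apply: (@tuple_product_agree n) => [i||].
- exact: mset_conv_agree.
- exact: measurable_xsection.
- apply/funext => t; rewrite /preimage /xsection/= !inE /=; congr A.
  apply/eq_restrictP => -[//|a y] yn.
  by rewrite /node/= tnth_mktuple perm1 /= /restrict -ltnS yn.
Qed.

Lemma branch_eval_agree (T : choiceType) (g h : T -> D) n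
    (Phi : probability (branch Sigma T) R) :
  (forall x, agree n (g x) (h x)) ->
  agree n.+1 (branch_eval (distribution Phi (branch_map g)))
             (branch_eval (distribution Phi (branch_map h))).
Proof.
move=> gh A.
(* A change of variables turns both sides into integrals against the same [Phi], to be compared
   pointwise. *)
have evalE (f : T -> D) : branch_eval (distribution Phi (branch_map f))
    (restrict n.+1 @^-1` A) =
    \int[Phi]_b branch_law (branch_map f b) (restrict n.+1 @^-1` A).
  rewrite /branch_eval.
  have mf : measurable_fun [set: branch Sigma T] (branch_map f) by [].
  have := ge0_integral_pushforward mf Phi measurableT
    (f := fun b => branch_law b (restrict n.+1 @^-1` A)).
  by apply => // b _; exact: measure_ge0.
rewrite [LHS]evalE [RHS]evalE.
by apply: eq_integral => b _; exact: branch_law_agree.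
Qed.

End unfolding.

(** * Projective limits *)

Section levels.
Context (Sigma : finType).

(* The carrier of wlang, with the algebra of level sets instead of the
   sigma-algebra it generates. *)
Definition flang : Type := seq Sigma -> nat.

HB.instance Definition _ := Pointed.copy flang (seq Sigma -> nat).

Definition level n (A : set flang) : Prop := restrict n @^-1` A = A.

Lemma level_le m n (A : set flang) : (m <= n)%N -> level m A -> level n A.
Proof. by rewrite /level => mn <-; rewrite restrict_idem. Qed.

Lemma level_restrict n (A : set (wlang Sigma)) : level n (restrict n @^-1` A).
Proof. by rewrite /level restrict_idem. Qed.

Lemma levelI n (A B : set flang) : level n A -> level n B -> level n (A `&` B).
Proof. by rewrite /level preimage_setI => -> ->. Qed.

Lemma levelU n (A B : set flang) : level n A -> level n B -> level n (A `|` B).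
Proof. by rewrite /level preimage_setU => -> ->. Qed.

Lemma level0 n : level n set0.
Proof. by rewrite /level preimage_set0. Qed.

Lemma level_eq n (A : set flang) (alpha beta : wlang Sigma) : level n A ->
  restrict n alpha = restrict n beta -> A alpha -> A beta.
Proof. by move=> + ab; rewrite /level => <-; rewrite /preimage/= ab. Qed.

Lemma measurable_level n (A : set flang) :
  level n A -> measurable (A : set (wlang Sigma)).
Proof. by move=> <-; exact: measurable_restrict_preimage. Qed.

Definition levels : set (set flang) := [set A | exists n, level n A].

Let levels0 : levels set0.
Proof. by exists 0%N; exact: level0. Qed.

Let levelsU : setU_closed levels.
Proof.
move=> A B [m lA] [n lB]; exists (maxn m n).
by apply: levelU; [apply: level_le lA|apply: level_le lB];
  rewrite (leq_maxl, leq_maxr).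
Qed.

Let levelsC : setC_closed levels.
Proof. by move=> A [n lA]; exists n; rewrite /level -preimage_setC lA. Qed.

Definition level_display : measure_display.
Proof. exact. Qed.

HB.instance Definition _ := @isAlgebraOfSets.Build level_display flang
  levels levels0 levelsU levelsC.

(** Classes are indexed by natural numbers so that masses can be summed as series; an index that
    codes nothing gives the empty class. *)
Definition code_class n j : set flang :=
  [set beta | pickle (code n beta) = j].

Lemma level_code_class n j : level n.+1 (code_class n j).
Proof.
apply/funext => beta; rewrite /code_class /preimage/=; congr (pickle _ = _).
by apply/code_eq; rewrite restrict_comp minnn.
Qed.

Lemma code_class_eq n j alpha beta :
  code_class n j alpha -> code_class n j beta ->
  restrict n.+1 alpha = restrict n.+1 beta.
Proof.
by move=> /= aj bj; apply/code_eq; apply: (pcan_inj pickleK); rewrite aj.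
Qed.

Lemma bigcup_code_class n : \bigcup_j code_class n j = setT.
Proof. by apply/seteqP; split => // beta _; exists (pickle (code n beta)). Qed.

Lemma trivIset_code_class n : trivIset setT (code_class n).
Proof. by move=> i j _ _ [beta [/= <- <-]]. Qed.

End levels.

Section projective_limit.
Context (R : realType) (Sigma : finType).
Local Notation D := (probability (wlang Sigma) R).
Variable P : nat -> D.
Hypothesis P_agree : forall m n, (n <= m)%N -> agree n (P m) (P n).

(* The mass of a level set does not depend on the level chosen here
   (premeasureE); sets that are not level sets get an arbitrary value. *)
Definition premeasure (A : set (flang Sigma)) : \bar R :=
  P (xget 0%N [set n | level n A]) A.

Local Notation nu := premeasure.

Lemma premeasureE n (A : set (flang Sigma)) : level n A -> nu A = P n A.
Proof.
move=> lA; rewrite /premeasure; set k := xget _ _.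
have lk : level k A by apply: (@xgetPex _ 0%N [set n | level n A]); exists n.
pose m := maxn k n.
have -> : P k A = P m A by rewrite -lk (P_agree (leq_maxl k n)).
by rewrite -lA (P_agree (leq_maxr k n)).
Qed.

Let nu_ge0 A : 0 <= nu A.
Proof. exact: measure_ge0. Qed.

(** Finitely many level sets share a level [N], where [nu] coincides with the measure [P N]. *)
Let nu_semi_additive : measure_function.semi_additive nu.
Proof.
move=> F n /choice[l lF] tF _.
pose N := \max_(i < n) l i.
have lN (i : 'I_n) : level N (F i).
  by apply: level_le (lF i); exact: (leq_bigmax i).
have lU : level N (\big[setU/set0]_(i < n) F i).
  by elim/big_ind : _ => [|A B|//]; [exact: level0|exact: levelU].
rewrite (premeasureE lU) (eq_bigr (fun i : 'I_n => P N (F i))); last first.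
  by move=> i _; rewrite (premeasureE (lN i)).
apply: (@measure_semi_additive _ _ _ (P N) F n) => //.
- by move=> k; exact: measurable_level (lF k).
- exact: measurable_level lU.
Qed.

HB.instance Definition _ :=
  isContent.Build _ _ R premeasure nu_ge0 nu_semi_additive.

(** Countable additivity is available here because all the pieces have one common level [k], so they
    are all measured by [P k]. *)
Lemma premeasure_split n m (A B : set (flang Sigma)) : level m A -> level m B ->
  nu (A `&` B) = \sum_(j <oo) nu (A `&` (B `&` code_class n j)).
Proof.
move=> lA lB; pose k := maxn m n.+1.
have lX j : level k (A `&` (B `&` code_class n j)).
  apply: levelI; first by apply: level_le lA; rewrite leq_maxl.
  apply: levelI; first by apply: level_le lB; rewrite leq_maxl.
  by apply: level_le (level_code_class _ n j); rewrite leq_maxr.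
have lAB : level k (A `&` B).
  by apply: level_le (levelI lA lB); rewrite leq_maxl.
rewrite (premeasureE lAB) (eq_eseriesr (fun j _ => premeasureE (lX j))).
have UE : A `&` B = \bigcup_j (A `&` (B `&` code_class n j)).
  by rewrite -setI_bigcupr -setI_bigcupr bigcup_code_class setIT.
rewrite {1}UE (@measure_semi_bigcup _ _ _ (P k))//.
- by move=> j; exact: measurable_level (lX j).
- move=> i j _ _ [beta [[_ [_ bi]] [_ [_ bj]]]].
  by apply: (@trivIset_code_class _ n) => //; exists beta.
- by rewrite -UE; exact: measurable_level lAB.
Qed.

Let nu_sigma_subadditive : measurable_subset_sigma_subadditive nu.
Proof.
move=> A F /choice[l lF] [k lA] AF; rewrite leNgt; apply/negP => FA.
pose bad B := (exists m, level m B) /\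
  \sum_(i <oo) nu (F i `&` B) < nu (A `&` B).
(* The masses of A and of its cover both split along the classes at a given
   level, so some class of a bad set is bad again. *)
have bad_split n B : exists j, bad B -> bad (B `&` code_class n j).
  apply: contrapT => /forallNP nbad.
  have [[m lB] FB] : bad B by apply: contrapT => nB; exact: (nbad 0%N).
  move: FB; rewrite ltNge => /negP; apply.
  rewrite (premeasure_split n (level_le (leq_maxl k m) lA)
    (level_le (leq_maxr k m) lB)).
  rewrite (eq_eseriesr (fun i _ => premeasure_split n
    (level_le (leq_maxl (l i) m) (lF i)) (level_le (leq_maxr (l i) m) lB))).
  rewrite nneseries_interchange//; apply: lee_nneseries => // j _.
  rewrite leNgt; apply/negP => FBj; apply: (nbad j) => _; split => //.
  exists (maxn m n.+1); apply: levelI; first exact: level_le (leq_maxl _ _) lB.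
  exact: level_le (leq_maxr _ _) (level_code_class _ n j).
have /choice[j jP] : forall nB : nat * set (flang Sigma),
    exists j, bad nB.2 -> bad (nB.2 `&` code_class nB.1 j).
  by move=> [n B]; exact: bad_split.
(* All elements of [B n] have the same weights on strings of length below n. *)
pose B := fix B n := if n is n'.+1 then B n' `&` code_class n' (j (n', B n'))
                     else setT.
have badB n : bad (B n).
  elim: n => [|n badn] /=; last exact: (jP (n, B n)).
  split; first by exists 0%N; rewrite /level preimage_setT.
  by rewrite setIT (eq_eseriesr (fun i _ => congr1 nu (setIT (F i)))).
have BS m n : (m <= n)%N -> B n `<=` B m.
  elim: n => [|n ih]; first by rewrite leqn0 => /eqP ->.
  by rewrite leq_eqVlt => /predU1P[->//|/ih BnBm] beta [/BnBm].
(* Badness makes the mass of this set exceed a nonnegative sum, so the set is nonempty. *)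
have /choice[b bP] : forall n, exists beta, (A `&` B n) beta.
  move=> n; apply/set0P/eqP => AB0; have [_] := badB n.
  by rewrite AB0 measure0 ltNge nneseries_ge0.
(* [B (size x).+1] is the first set of the branch that is sure to fix the weight of [x]. *)
pose alpha : wlang Sigma := fun x => (b (size x).+1 : seq Sigma -> nat) x.
have alphaP n beta : B n beta -> restrict n beta = restrict n alpha.
  move=> Bn; apply/eq_restrictP => x xn.
  have [_ bx] := (bP (size x).+1).2; have [_ betax] := BS _ _ xn _ Bn.
  by have /eq_restrictP -> := code_class_eq betax bx.
have Aalpha : A alpha.
  by have [Ab Bb] := bP k; exact: level_eq lA (alphaP _ _ Bb) Ab.
have [i _ Falpha] := AF _ Aalpha.
have [[m lB]] := badB (l i); rewrite ltNge => /negP; apply.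
(* As [F i] has level [l i] and contains [alpha], it contains all of [B (l i)]; its term alone then
   outweighs [A] there, against badness. *)
apply: (@le_trans _ _ (nu (F i `&` B (l i)))).
  apply: le_measure; rewrite ?inE.
  - by apply: measurableI; [exists k|exists m].
  - by apply: measurableI; [exists (l i)|exists m].
  - move=> beta [_ Bb]; split => //.
    by apply: level_eq (lF i) _ Falpha; rewrite (alphaP _ _ Bb).
apply: le_trans (nneseries_lim_ge i.+1 _) => //.
by rewrite big_nat_recr//= leeDr// sume_ge0.
Qed.

HB.instance Definition _ := Content_SigmaSubAdditive_isMeasure.Build
  level_display R (flang Sigma) premeasure nu_sigma_subadditive.

Definition limit_measure (A : set (wlang Sigma)) : \bar R :=
  measure_extension premeasure A.

Let limit_measure_semi_sigma_additive : semi_sigma_additive limit_measure.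
Proof.
(* Cylinders are level sets, so the extension is countably additive on the measurable sets of
   [wlang]. *)
have wl : @measurable _ (wlang Sigma) `<=` <<s @measurable _ (flang Sigma) >>.
  apply: smallest_sub; first exact: smallest_sigma_algebra.
  move=> _ [alpha [n ->]]; apply: sub_sigma_algebra; exists n.+1.
  by rewrite cylinder_restrict; exact: level_restrict.
move=> F mF tF mUF.
apply: (@measure_semi_sigma_additive _ _ _ (measure_extension premeasure) F).
- by move=> i; exact: wl (mF i).
- exact: tF.
- exact: wl mUF.
Qed.

HB.instance Definition _ := isMeasure.Build _ _ _ limit_measure
  (measure0 (measure_extension premeasure))
  (measure_ge0 (measure_extension premeasure))
  limit_measure_semi_sigma_additive.

Lemma limit_measureE n A :
  limit_measure (restrict n @^-1` A) = P n (restrict n @^-1` A).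
Proof.
have lA := level_restrict n A.
rewrite -(premeasureE lA); apply: measurable_mu_extE.
by exists n.
Qed.

Let limit_measure_setT : limit_measure setT = 1.
Proof.
by rewrite -(preimage_setT (restrict 0)) limit_measureE preimage_setT
  probability_setT.
Qed.

HB.instance Definition _ :=
  Measure_isProbability.Build _ _ _ limit_measure limit_measure_setT.

Lemma projective_limit : exists Q : D, forall n, agree n Q (P n).
Proof. by exists limit_measure => n A; exact: limit_measureE. Qed.

End projective_limit.

Theorem theorem7p2 (R : realType) (Sigma S : finType)
    (delta : S -> probability (branch Sigma S) R) :
  exists sem : S -> probability (wlang Sigma) R,
    (forall s, sem s ≡μ branch_eval (distribution (delta s) (branch_map sem))) /\
    (forall sem' : S -> probability (wlang Sigma) R,
      (forall s, sem' s ≡μ branch_eval (distribution (delta s) (branch_map sem'))) ->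
      forall s, sem' s ≡μ sem s).
Proof.
pose step (g : S -> probability (wlang Sigma) R) s :
    probability (wlang Sigma) R :=
  branch_eval (distribution (delta s) (branch_map g)).
(* The starting law is arbitrary, since any two laws agree at level 0. *)
pose sem_ n := iter n step (fun=> dirac (point : wlang Sigma)).
have stepP n g h : (forall s, agree n (g s) (h s)) ->
    forall s, agree n.+1 (step g s) (step h s).
  by move=> gh s; exact: branch_eval_agree.
have sem_agree s m n : (n <= m)%N -> agree n (sem_ m s) (sem_ n s).
  elim: n m s => [|n ih] [|m] s nm; try exact: agree0; first by [].
  by apply: stepP => {}s; exact: ih.
have /choice[sem semP] : forall s, exists Q : probability (wlang Sigma) R,
    forall n, agree n Q (sem_ n s).
  by move=> s; exact: projective_limit (sem_agree s).
exists sem; split=> [s|sem' sem'E s]; apply: agree_measure_eq => n.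
  (* At level n + 1, both [sem] and [step sem] agree with the iterate [sem_ n.+1], which is
     [step (sem_ n)]. *)
  apply: (@agree_le _ _ n n.+1); first exact: leqnSn.
  apply: agree_trans (semP s n.+1) _; apply: agree_sym.
  by apply: (stepP n sem (sem_ n)) => {}s; exact: semP.
(* By induction on n, any fixed point agrees with the n-th iterate at level n. *)
apply: agree_trans (agree_sym (semP s n)).
elim: n s => [|n ih] s; first exact: agree0.
apply: agree_trans (measure_eq_agree n.+1 (sem'E s)) _.
by apply: (stepP n sem' (sem_ n)) => {}s; exact: ih.
Qed.
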